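(* Let $h_1,\dots,h_n\in\mathbb{R}\setminus\{0\}$ and $\pi_i=|h_i|/\sum_{j}|h_j|$ for $1\le i\le n$. Consider the directed graph with vertex set $\{S,T\}\cup\{H^{prev}_1,\dots,H^{prev}_n\}\cup\{H^{next}_1,\dots,H^{next}_n\}$ and with edges $\langle S,H^{prev}_i\rangle$, $\langle H^{prev}_i,H^{next}_j\rangle$ and $\langle H^{next}_j,T\rangle$ for all $1\le i,j\le n$. Let $f$ be a flow on this graph, i.e. a real-valued function on the edges such that flow is conserved at every vertex other than $S$ and $T$: $$f(\langle S,H^{prev}_i\rangle)=\sum_j f(\langle H^{prev}_i,H^{next}_j\rangle),\qquad f(\langle H^{next}_i,T\rangle)=\sum_j f(\langle H^{prev}_j,H^{next}_i\rangle)\qquad(1\le i\le n).$$ Suppose that $$f(\langle S,H^{prev}_i\rangle)=f(\langle H^{next}_i,T\rangle)=\pi_i\qquad\text{for all }1\le i\le n.$$ Then the matrix $\mathbf{P}=(p_{ij})$ extracted from the flow, defined by $$p_{ij}=\frac{f(\langle H^{prev}_i,H^{next}_j\rangle)}{f(\langle S,H^{prev}_i\rangle)},$$ preserves the distribution $\pi=(\pi_1,\dots,\pi_n)$: $\ \pi\mathbf{P}=\pi$.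
   Context: Here $h_j$ are the coefficients of a Hamiltonian decomposition $\mathcal{H}=\sum_{j=1}^n h_jH_j$; $H_i^{prev}$ and $H_i^{next}$ are just two copies of a vertex representing the $i$-th term, $S$ is the source and $T$ the sink. $\pi$ is regarded as a row vector. *)

(* Defs.v *)
From HB Require Import structures.
From mathcomp Require Import all_boot all_order all_algebra.
From mathcomp Require Import reals.

Set Implicit Arguments.
Unset Strict Implicit.
Unset Printing Implicit Defensive.

Import Order.TTheory GRing.Theory Num.Theory.

Local Open Scope ring_scope.

Inductive vertex (n : nat) : Type :=
  | Source
  | Sink
  | Hprev of 'I_n
  | Hnext of 'I_n.

Arguments Source {n}.
Arguments Sink {n}.

Section VertexFinType.
Variable n : nat.

Definition vertex_code (v : vertex n) : bool + ('I_n + 'I_n) :=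
  match v with
  | Source => inl false
  | Sink => inl true
  | Hprev i => inr (inl i)
  | Hnext i => inr (inr i)
  end.

Definition vertex_decode (c : bool + ('I_n + 'I_n)) : vertex n :=
  match c with
  | inl false => Source
  | inl true => Sink
  | inr (inl i) => Hprev i
  | inr (inr i) => Hnext i
  end.

Lemma vertex_codeK : cancel vertex_code vertex_decode.
Proof. by case. Qed.

HB.instance Definition _ := Equality.copy (vertex n) (can_type vertex_codeK).
HB.instance Definition _ := Choice.copy (vertex n) (can_type vertex_codeK).
HB.instance Definition _ := Countable.copy (vertex n) (can_type vertex_codeK).
HB.instance Definition _ : isFinite (vertex n) := CanIsFinite vertex_codeK.

End VertexFinType.

Definition adj (n : nat) (u v : vertex n) : bool :=
  match u, v with
  | Source, Hprev _ => true
  | Hprev _, Hnext _ => true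
  | Hnext _, Sink => true
  | _, _ => false
  end.

Definition edge (n : nat) : Type := {e : vertex n * vertex n | adj e.1 e.2}.

Definition edge_in (n : nat) (i : 'I_n) : edge n :=
  exist _ (Source, Hprev i) isT.
Definition edge_mid (n : nat) (i j : 'I_n) : edge n :=
  exist _ (Hprev i, Hnext j) isT.
Definition edge_out (n : nat) (j : 'I_n) : edge n :=
  exist _ (Hnext j, Sink) isT.

(* Flow values are arbitrary reals: neither nonnegativity nor a
   capacity bound is imposed. *)
Definition is_flow (R : realType) (n : nat) (f : edge n -> R) : Prop :=
  forall v : vertex n, v != Source -> v != Sink ->
    \sum_(e : edge n | (val e).2 == v) f e =
    \sum_(e : edge n | (val e).1 == v) f e.

Lemma sum_edge_uniq (R : realType) (n : nat) (f : edge n -> R)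
    (P : pred (edge n)) (e0 : edge n) :
  P =1 pred1 e0 -> \sum_(e | P e) f e = f e0.
Proof. by move=> PE; rewrite (eq_bigl _ _ PE) big_pred1_eq. Qed.

Lemma sum_edge_image (R : realType) (n : nat) (f : edge n -> R)
    (P : pred (edge n)) (g : 'I_n -> edge n) (g' : edge n -> 'I_n) :
  cancel g g' -> (forall e, P e -> g (g' e) = e) -> (forall i, P (g i)) ->
  \sum_(e | P e) f e = \sum_i f (g i).
Proof.
move=> gK g'K Pg; rewrite (reindex_onto g g') //.
by apply: eq_bigl => i; rewrite Pg gK eqxx.
Qed.

Lemma is_flowP (R : realType) (n : nat) (f : edge n -> R) :
  is_flow f <->
  (forall i, f (edge_in i) = \sum_j f (edge_mid i j)) /\
  (forall i, f (edge_out i) = \sum_j f (edge_mid j i)).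
Proof.
have inP i : \sum_(e : edge n | (val e).2 == Hprev i) f e = f (edge_in i).
  apply: sum_edge_uniq => -[[u v] uv] /=; rewrite -val_eqE /= xpair_eqE.
  by case: u v uv => [||k|k] [||l|l] //= _; rewrite ?andbF.
have outP i : \sum_(e : edge n | (val e).1 == Hnext i) f e = f (edge_out i).
  apply: sum_edge_uniq => -[[u v] uv] /=; rewrite -val_eqE /= xpair_eqE.
  by case: u v uv => [||k|k] [||l|l] //= _; rewrite ?andbT.
have midl i : \sum_(e : edge n | (val e).1 == Hprev i) f e =
    \sum_j f (edge_mid i j).
  apply: (@sum_edge_image _ _ _ _ _
    (fun e => if (val e).2 is Hnext j then j else i)) => // -[[u v] uv] /= /eqP.
  by move=> uE; apply: val_inj; move: uv; rewrite /= uE; case: v.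
have midr i : \sum_(e : edge n | (val e).2 == Hnext i) f e =
    \sum_j f (edge_mid j i).
  apply: (@sum_edge_image _ _ _ _ (fun j => edge_mid j i)
    (fun e => if (val e).1 is Hprev j then j else i)) => // -[[u v] uv] /= /eqP.
  by move=> vE; apply: val_inj; move: uv; rewrite /= vE; case: u.
split=> [ff | [fp fn] [||i|i] //= _ _].
- by split=> i; [rewrite -inP -midl | rewrite -outP -midr]; rewrite ff.
- by rewrite inP midl.
- by rewrite midr outP.
Qed.

Definition hdist (R : realType) (n : nat) (h : 'I_n -> R) : 'rV[R]_n :=
  \row_i (`|h i| / \sum_j `|h j|).

Definition flow_matrix (R : realType) (n : nat) (f : edge n -> R) : 'M[R]_n :=
  \matrix_(i, j) (f (edge_mid i j) / f (edge_in i)).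

(* Main.v *)
Require Import Defs.
From mathcomp Require Import all_boot all_order all_algebra.
From mathcomp Require Import reals.

Local Open Scope ring_scope.

(** Weighting row [i] of [flow_matrix f] by its own denominator, the inflow of [Hprev i], restores
    the edge flows; column [j] then sums to the inflow of [Hnext j], which conservation equates with
    its outflow. *)

Lemma hdist_neq0 (R : realType) (n : nat) (h : 'I_n -> R) (i : 'I_n) :
  h i != 0 -> hdist h 0 i != 0.
Proof.
move=> hi; rewrite mxE GRing.mulf_neq0 ?Num.Theory.normr_eq0 //.
(* The normalising sum is nonzero because its [i]-th term is already positive. *)
rewrite GRing.invr_eq0 Num.Theory.psumr_neq0 //.
by apply/hasP; exists i; rewrite ?mem_index_enum //= Num.Theory.normr_gt0.
Qed.

Theorem theorem5p1 (R : realType) (n : nat) (h : 'I_n -> R)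
    (h_neq0 : forall i : 'I_n, h i != 0)
    (f : edge n -> R) (f_flow : is_flow f)
    (f_in : forall i : 'I_n, f (edge_in i) = hdist h 0 i)
    (f_out : forall i : 'I_n, f (edge_out i) = hdist h 0 i) :
  hdist h *m flow_matrix f = hdist h.
Proof.
have [_ f_next] := (is_flowP f).1 f_flow.
(* Both sides become sums over [i], compared termwise. *)
apply/rowP => j; rewrite -f_out f_next mxE; apply: eq_bigr => i _.
by rewrite [flow_matrix f i j]mxE f_in GRing.mulrC GRing.divfK ?hdist_neq0.
Qed.
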